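(* Let $k\ge 1$ and $\ell\geq 2$ be integers, and let $D$ be a digraph with $\delta^+(D)\geq f(k,\ell)$. Then $D$ contains a subdivision of $B(k,\ell)$.
   Context: $\delta^+(D)$ is the minimum out-degree. A subdivision of a digraph $F$ is obtained by replacing each arc $(x,y)$ by a directed $(x,y)$-path, these paths being internally disjoint with new internal vertices; ''contains'' means as a subdigraph. The $\ell$-branching in-arborescence of depth $k$, $B(k,\ell)$, is defined inductively: $B(0,\ell)$ is a single vertex, which is its root and its unique leaf; $B(k,\ell)$ is obtained from $B(k-1,\ell)$ by adding, for each leaf of $B(k-1,\ell)$, $\ell$ new vertices each with an arc to that leaf; the root of $B(k,\ell)$ is that of $B(k-1,\ell)$ and its leaves are the newly added vertices. Let $b(k,\ell)=\sum_{i=0}^{k}\ell^i$ (the number of vertices of $B(k,\ell)$). The function $f$ is defined recursively for integers $k\ge1$, $\ell\ge2$ by $f(1,\ell)=\ell$ and, for $k\ge 2$, $f(k,\ell)=t(k,\ell)\cdot(\ell-1)\cdot k+t(k,\ell)$, where $t(k,\ell)=f\big(k-1,\ b(k-1,\ell)\cdot(\ell-1)+1\big)\cdot b(k-1,\ell)$. *)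

(* Defs.v *)
From mathcomp Require Import all_boot.
Set Implicit Arguments. Unset Strict Implicit. Unset Printing Implicit Defensive.

(* A (finite, loopless) digraph is a finType T with an irreflexive arc
   relation E : rel T (arc (x,y) iff E x y).  No parallel arcs by construction;
   digons are allowed. *)

Definition outdeg (T : finType) (E : rel T) (v : T) : nat := #|[set w | E v w]|.

Definition b (k l : nat) : nat := \sum_(i < k.+1) l ^ i.

(* f(1,l) = l ; f(k,l) = t(k,l)*(l-1)*k + t(k,l),
   t(k,l) = f(k-1, b(k-1,l)*(l-1)+1) * b(k-1,l).  (f 0 l is unused.) *)
Fixpoint f (k l : nat) {struct k} : nat :=
  match k with
  | 0 => 0
  | k'.+1 =>
      if k' is 0 then l
      else let t := f k' (b k' l * (l - 1) + 1) * b k' l in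
           t * (l - 1) * k + t
  end.

(* Vertices of B(k,l): words over 'I_l of length d <= k (the word records the
   sequence of choices from the root; the root is the empty word). *)
Definition Bvert (k l : nat) : finType := {d : 'I_k.+1 & d.-tuple 'I_l}.

(* Arc u -> v iff v is the parent of u, i.e. u = v followed by one letter. *)
Definition Barc (k l : nat) : rel (Bvert k l) :=
  fun u v =>
    let su := val (tagged u) in
    let sv := val (tagged v) in
    (size su == (size sv).+1) && (take (size sv) su == sv).

(* D = (T,E) contains a subdivision of F = (V,eF): an injective map phi of the
   vertices of F into T, and for each arc (x,y) of F a directed (phi x, phi y)-path
   in D, given by its list of internal vertices P x y; internal vertices are
   pairwise distinct, not images of phi, and paths of distinct arcs are
   internally disjoint. *)
Definition contains_subdivision (V : finType) (eF : rel V)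
    (T : finType) (E : rel T) : Prop :=
  exists (phi : V -> T) (P : V -> V -> seq T),
    [/\ injective phi,
        forall x y, eF x y -> path E (phi x) (rcons (P x y) (phi y)),
        forall x y, eF x y -> uniq (P x y),
        forall x y w, eF x y -> w \in P x y -> forall z, phi z != w &
        forall x y x' y', eF x y -> eF x' y' ->
          forall w, w \in P x y -> w \in P x' y' -> (x, y) = (x', y')].

(* Main.v *)
Require Import Defs.
From mathcomp Require Import all_boot zify.
Set Implicit Arguments. Unset Strict Implicit. Unset Printing Implicit Defensive.

(* Induction on [k].  Partition the vertices into as few pieces as possible, each
   containing a spanning B(i,l) with [i < k], the one-vertex pieces being B(0,l).
   If some one-vertex piece [v] had [l] in-neighbours that are roots of equal
   depth, the pieces could be merged at [v]; so [v] has at most [k * (l - 1)]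
   in-neighbours among the roots.  By Hall's theorem, all roots with at least
   [k * (l - 1)] arcs to one-vertex pieces can be matched along arcs to distinct
   one-vertex pieces.  Follow this matching from the root of a larger piece until
   it stops at a vertex, its tip: these walks are disjoint, and a tip sends so many
   arcs to larger pieces, of at most [b (k-1) l] vertices each, that it meets more
   than [f (k-1) m] of them, where [m = b (k-1) l * (l - 1) + 1].  The digraph of
   larger pieces thus contains a subdivision of B(k-1,m).  Among [m] arcs entering
   a piece, [l] enter at the same vertex, which reaches the tip inside the piece
   and its walk; and each leaf is a piece, hence contains B(1,l). *)

(** * Matchings *)

Lemma set_injection (T : finType) (n : nat) (A : {set T}) : n <= #|A| ->
  exists x : 'I_n -> T, injective x /\ forall i, x i \in A.
Proof.
move=> leA; exists (fun i => enum_val (widen_ord leA i)); split=> [i j|i].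
  by move/enum_val_inj/(congr1 val)=> /= eq_ij; apply: val_inj.
exact: enum_valP.
Qed.

Lemma leq_card_fibers (I J : finType) (g : I -> J) (A : {set I}) (n : nat) :
  (forall j, #|[set i in A | g i == j]| <= n) -> #|A| <= n * #|g @: A|.
Proof.
move=> le_n; rewrite -sum1_card (partition_big g (mem (g @: A))) /=; last first.
  by move=> i iA; apply: imset_f.
rewrite mulnC -sum_nat_const; apply: leq_sum => j _.
by apply: leq_trans (le_n j); rewrite -sum1_card; apply: eq_leq; apply: eq_bigl => i; rewrite inE.
Qed.

Lemma double_counting (T : finType) (E : rel T) (A B : {set T}) (c d : nat) :
  {in A, forall x, d <= #|[set y in B | E x y]|} ->
  {in B, forall y, #|[set x in A | E x y]| <= c} ->
  d * #|A| <= c * #|B|.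
Proof.
move=> leA leB; rewrite mulnC (mulnC c) -!sum_nat_const.
apply: leq_trans (leq_sum _ leA) _; apply: leq_trans (leq_sum _ leB).
have E1 (C : {set T}) (P : pred T) : #|[set y in C | P y]| = \sum_(y in C) P y.
  by rewrite -sum1_card -big_mkcondr; apply: eq_bigl => y; rewrite inE.
under eq_bigr => x _ do rewrite E1.
by rewrite exchange_big /=; apply: eq_leq; apply: eq_bigr => y _; rewrite E1.
Qed.

(* Rado's argument: while some [N x0] has two elements [y1], [y2], one of them
   can be deleted; otherwise two sets violate Hall's condition after the two
   deletions, and submodularity of [A |-> #|N A|] contradicts it before. *)
Lemma hall (T : finType) (N : T -> {set T}) (X : {set T}) :
  (forall A : {set T}, A \subset X -> #|A| <= #|\bigcup_(x in A) N x|) ->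
  exists s : T -> T, {in X, forall x, s x \in N x} /\ {in X &, injective s}.
Proof.
have [n] := ubnP (\sum_(x in X) #|N x|); elim: n N => // n IH N ltn hN.
have [|] := boolP [exists x in X, 1 < #|N x|]; last first.
  rewrite negb_exists_in => /forall_inP le1.
  have N0 x : x \in X -> exists y, N x = [set y].
    move=> xX; apply/cards1P; rewrite eqn_leq leqNgt le1 //=.
    by have := hN [set x]; rewrite sub1set cards1 big_set1; apply.
  exists (fun x => odflt x [pick y in N x]); split=> [x xX|x y xX yX].
    by have [y ->] := N0 x xX; case: pickP => //= /(_ y); rewrite inE eqxx.
  have [[u Nx] [v Ny]] := (N0 x xX, N0 y yX); rewrite Nx Ny.
  case: pickP => [_ /set1P->|/(_ u)]; last by rewrite inE eqxx.
  case: pickP => [_ /set1P->|/(_ v)]; last by rewrite inE eqxx.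
  move=> /= uv; apply/eqP; rewrite -[_ == _]negbK; apply/negP => neq_xy.
  have := hN [set x; y]; rewrite cards2 neq_xy big_setU1 ?inE //= big_set1.
  rewrite Nx Ny uv setUid cards1 => /(_ _)/negP; case=> //.
  by apply/subsetP => z /set2P[]->.
case/exists_inP => x0 x0X /card_gt1P[y1 [y2 [y1N y2N neq_y]]].
pose N' y x := if x == x0 then N x0 :\ y else N x.
have N'S y x : N' y x \subset N x.
  by rewrite /N'; case: eqP => [->|_]; rewrite ?subD1set.
have step y : y \in N x0 ->
    (forall A : {set T}, A \subset X -> #|A| <= #|\bigcup_(x in A) N' y x|) ->
    exists s : T -> T, {in X, forall x, s x \in N x} /\ {in X &, injective s}.
  move=> yN /IH[|s [sN s_inj]].
    rewrite -ltnS; apply: leq_trans ltn; rewrite ltnS.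
    rewrite !(bigD1 x0 x0X) /= -addSn; apply: leq_add.
      by rewrite /N' eqxx (cardsD1 y (N x0)) yN.
    by apply: leq_sum => x _; apply: subset_leq_card.
  by exists s; split=> // x /sN; apply/subsetP/N'S.
pose bad y (A : {set T}) := (A \subset X) && (#|\bigcup_(x in A) N' y x| < #|A|).
have [/existsP[A1]|] := boolP [exists A, bad y1 A]; last first.
  move/existsPn => good; apply: (step y1) => // A AX.
  by have := good A; rewrite /bad AX /= -leqNgt.
have [/existsP[A2]|] := boolP [exists A, bad y2 A]; last first.
  move/existsPn => good _; apply: (step y2) => // A AX.
  by have := good A; rewrite /bad AX /= -leqNgt.
move=> /andP[A2X lt2] /andP[A1X lt1]; exfalso.
(* Deleting [y] changes only the set of [x0], so a set violating the condition must contain [x0]. *)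
have x0A y (A : {set T}) :
    A \subset X -> #|\bigcup_(x in A) N' y x| < #|A| -> x0 \in A.
  move=> AX ltA; apply: contraLR ltA => x0NA; rewrite -leqNgt.
  rewrite (eq_bigr N) ?hN // => x xA; rewrite /N'; case: eqP => // eq_x.
  by rewrite -eq_x xA in x0NA.
have x0A1 := x0A _ _ A1X lt1; have x0A2 := x0A _ _ A2X lt2.
set U1 := \bigcup_(x in A1) _ in lt1; set U2 := \bigcup_(x in A2) _ in lt2.
(* Since [y1] and [y2] differ, each element of [N x0] survives one of the two deletions, so the
   union loses nothing. *)
have leU : #|A1 :|: A2| <= #|U1 :|: U2|.
  apply: leq_trans (hN _ _) (subset_leq_card _); first by rewrite subUset A1X.
  apply/bigcupsP => x; have [->{x} _|neq_x xA] := eqVneq x x0.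
    apply/subsetP => y yN; rewrite inE; have [eq_y|neq_y1] := eqVneq y y1.
      apply/orP; right; apply/bigcupP; exists x0 => //.
      by rewrite /N' eqxx !inE yN eq_y neq_y.
    by apply/orP; left; apply/bigcupP; exists x0; rewrite // /N' eqxx !inE neq_y1.
  have N'x y : N x = N' y x by rewrite /N' (negPf neq_x).
  case/setUP: xA => xA; apply/subsetP => z zN; rewrite inE; apply/orP.
    by left; apply/bigcupP; exists x; rewrite // -N'x.
  by right; apply/bigcupP; exists x; rewrite // -N'x.
have leI : #|(A1 :&: A2) :\ x0| <= #|U1 :&: U2|.
  apply: leq_trans (hN _ _) (subset_leq_card _).
    by apply/subsetP => x /setD1P[_ /setIP[/(subsetP A1X)]].
  apply/bigcupsP => x /setD1P[neq_x /setIP[xA1 xA2]].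
  have N'x y : N x = N' y x by rewrite /N' (negPf neq_x).
  by rewrite subsetI {1}(N'x y1) (N'x y2) !bigcup_sup.
(* The violations give [#|U1| + #|U2| <= #|A1| + #|A2| - 2], whereas [leU] and [leI] bound the same
   sum below by [#|A1| + #|A2| - 1]. *)
have := cardsUI A1 A2; have := cardsUI U1 U2.
have := cardsD1 x0 (A1 :&: A2); rewrite inE x0A1 x0A2 /=.
lia.
Qed.

(** Hall's condition for [C] follows by counting the arcs from [C] to its neighbours in [B]: at
    least [c] leave each vertex of [C], and at most [c] enter each neighbour. *)
Lemma regular_matching (T : finType) (E : rel T) (A B : {set T}) (c : nat) :
  0 < c -> {in A, forall x, c <= #|[set y in B | E x y]|} ->
  {in B, forall y, #|[set x in A | E x y]| <= c} ->
  exists s : T -> T,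
    {in A, forall x, s x \in B /\ E x (s x)} /\ {in A &, injective s}.
Proof.
move=> c_gt0 leA leB.
have [|s [sN s_inj]] := @hall _ (fun x => [set y in B | E x y]) A; last first.
  by exists s; split=> // x /sN; rewrite inE => /andP.
move=> C CA; rewrite -(leq_pmul2l c_gt0); apply: (double_counting (E := E)).
  move=> x xC; apply: leq_trans (leA x (subsetP CA x xC)) (subset_leq_card _).
  apply/subsetP => y; rewrite [_ \in _]inE => yP; rewrite inE.
  case/andP: (yP) => _ ->; rewrite andbT; apply/bigcupP; exists x => //.
  by rewrite inE.
move=> y /bigcupP[x xC]; rewrite inE => /andP[/leB le_c _].
apply: leq_trans le_c; apply: subset_leq_card; apply/subsetP => z.
by rewrite !inE => /andP[/(subsetP CA)->].
Qed.

(** * Subdivided arborescences with a tail *)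

(* Inside [A] there is a subdivision of B(k,l), followed by a
   directed path from its root to [x]. *)
Inductive tree (T : finType) (E : rel T) (l : nat) : nat -> T -> {set T} -> Prop :=
| TreeLeaf x (A : {set T}) of x \in A : tree E l 0 x A
| TreeStep k x y (A B : {set T}) of tree E l k x A & E x y & y \notin A & A \subset B & y \in B :
    tree E l k y B
| TreeMerge k (x : 'I_l -> T) y (A : 'I_l -> {set T}) (B : {set T}) of
    (forall i, tree E l k (x i) (A i)) & (forall i, E (x i) y) &
    (forall i, y \notin A i) & (forall i j, i != j -> [disjoint A i & A j]) &
    (forall i, A i \subset B) & y \in B :
    tree E l k.+1 y B.

Lemma tree_sub (T : finType) (E : rel T) (l k : nat) x (A B : {set T}) :
  A \subset B -> tree E l k x A -> tree E l k x B.
Proof.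
move=> AB tA; case: tA AB => [{}x {}A xA|{}k {}x y A0 {}A tA0 xy yA0 A0A yA|
    {}k z y C {}A tC zy yC dC CA yA] AB.
- by apply: TreeLeaf; apply: (subsetP AB).
- by apply: (TreeStep tA0 xy yA0 (subset_trans A0A AB)); apply: (subsetP AB).
- apply: (TreeMerge tC zy yC dC) => [i|]; first exact: subset_trans (CA i) AB.
  exact: (subsetP AB).
Qed.

(** A merge cut down to depth 0 becomes its single vertex; the tails are kept. *)
Lemma tree_leq (T : finType) (E : rel T) (l k j : nat) x (A : {set T}) :
  j <= k -> tree E l k x A -> tree E l j x A.
Proof.
move=> le_jk tA; elim: tA j le_jk => {k x A} [x A xA|k x y A B _ IH xy yA AB yB|
    k x y A B _ IH xy yA dA AB yB] j.
- by rewrite leqn0 => /eqP->; apply: TreeLeaf.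
- by move=> /IH tA; apply: TreeStep yB; eauto.
- case: j => [|j] le_jk; first exact: TreeLeaf.
  by apply: (@TreeMerge _ _ _ _ x y A) => // i; apply: IH.
Qed.

Lemma tree_path (T : finType) (E : rel T) (l k : nat) x p (A B : {set T}) :
  tree E l k x A -> path E x p -> uniq p -> {in p, forall y, y \notin A} ->
  A \subset B -> {subset p <= B} -> tree E l k (last x p) B.
Proof.
elim: p x A => [|y p IH] x A tA /=; first by move=> _ _ _ AB _; apply: tree_sub tA.
case/andP=> xy yp /andP[y_p p_uniq] pA AB pB.
have yA : y \notin A by apply: pA; rewrite mem_head.
have yB : y \in B by apply: pB; rewrite mem_head.
apply: (IH y (y |: A)) => //.
- by apply: (TreeStep tA xy yA); rewrite ?subsetUr // !inE eqxx.
- move=> z zp; rewrite !inE negb_or pA ?inE ?zp ?orbT // andbT.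
  by apply: contraNneq y_p => <-.
- by rewrite subUset sub1set yB.
- by move=> z zp; apply: pB; rewrite inE zp orbT.
Qed.

Definition restrict (T : finType) (E : rel T) (A : {set T}) : rel T :=
  [rel x y | [&& E x y, x \in A & y \in A]].

Lemma restrict_sub (T : finType) (E : rel T) (A B : {set T}) x y :
  A \subset B -> connect (restrict E A) x y -> connect (restrict E B) x y.
Proof.
move=> AB; apply: connect_sub => u v /and3P[uv uA vA]; apply: connect1.
by rewrite /restrict /= uv !(subsetP AB).
Qed.

Lemma path_restrict (T : finType) (E : rel T) (A : {set T}) x p :
  x \in A -> path (restrict E A) x p = path E x p && all (mem A) p.
Proof.
elim: p x => //= y p IH x xA.
have ->: restrict E A x y = E x y && (y \in A) by rewrite /restrict /= xA.
by case yA: (y \in A); rewrite /= ?andbF // IH // andbT andbA.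
Qed.

(** A walk in [Z] from [x] is shortened to a simple path; as [Z] meets [A] only in [x], this path
    can be appended to the tail. *)
Lemma tree_connect (T : finType) (E : rel T) (l k : nat) x z (A B Z : {set T}) :
  tree E l k x A -> x \in Z -> {in A & Z, forall y z, y = z -> y = x} ->
  A \subset B -> Z \subset B -> connect (restrict E Z) x z -> tree E l k z B.
Proof.
move=> tA xZ AZ AB ZB /connectP[p0 + ->].
move=> /shortenP[p + p_uniq _]; rewrite path_restrict // => /andP[xp /allP pZ].
case/andP: p_uniq => x_p p_uniq.
apply: (tree_path tA) => // y yp; last by apply: (subsetP ZB); apply: pZ.
by apply: contra x_p => yA; rewrite -(AZ y y) //; apply: pZ.
Qed.

Lemma tree_mem (T : finType) (E : rel T) (l k : nat) x (A : {set T}) :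
  tree E l k x A -> x \in A.
Proof. by case. Qed.

(* Each word [w] gets the branch vertex [phi w] and the inner vertices [P w] of
   the path towards the parent of [w]; for the empty word, [P] is the tail. *)
Lemma tree_words (T : finType) (E : rel T) (l k : nat) y (A : {set T}) :
  tree E l k y A -> exists (phi : seq 'I_l -> T) (P : seq 'I_l -> seq T),
    [/\ forall w, size w <= k -> uniq (phi w :: P w) /\ {subset phi w :: P w <= A},
        forall w w' z, size w <= k -> size w' <= k ->
          z \in phi w :: P w -> z \in phi w' :: P w' -> w = w',
        forall w i, size w < k ->
          path E (phi (rcons w i)) (rcons (P (rcons w i)) (phi w)) &
        path E (phi [::]) (P [::]) /\ last (phi [::]) (P [::]) = y].
Proof.
elim=> {k y A} [x A xA|k x y A B _ [phi [P [wA dA ch [px lx]]]] xy yA AB yB|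
    k x y A B _ IH xy yA dA AB yB].
- exists (fun=> x), (fun=> [::]); split=> //.
    by move=> w _; split=> // z; rewrite inE => /eqP->.
  by move=> [|i w] [|i' w'].
(* A step lengthens only the tail, which is indexed by the empty word. *)
- pose Q w := if w is [::] then rcons (P w) y else P w.
  have memQ w z : z \in phi w :: Q w -> z \in phi w :: P w \/ w = [::] /\ z = y.
    case: w => [|i w] /=; last by left.
    by rewrite -rcons_cons mem_rcons inE => /predU1P[->|]; [right|left].
  exists phi, Q; split.
  + move=> w lew; have [w_uniq wsub] := wA w lew.
    split; last by move=> z /memQ[/wsub/(subsetP AB)|[_ ->]].
    case: w lew w_uniq wsub => // lew w_uniq wsub.
    rewrite /Q -rcons_cons rcons_uniq w_uniq andbT.
    by apply: contra yA => /wsub.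
  + move=> w w' z lew lew' /memQ[zw|[-> ->]] /memQ[zw'|[-> zy]] //.
    * exact: dA zw zw'.
    * by have [_ /(_ z zw)] := wA w lew; rewrite zy (negPf yA).
    * by have [_ /(_ y zw')] := wA w' lew'; rewrite (negPf yA).
  + by move=> w i lew; have := ch w i lew; case: w lew.
  + by rewrite /= rcons_path px lx last_rcons.
have {IH}[phi /fin_all_exists[P hP]] := fin_all_exists IH.
have wA i w : size w <= k -> uniq (phi i w :: P i w) /\ {subset phi i w :: P i w <= A i}.
  by case: (hP i) => + _ _ _; apply.
(* The first letter selects the subtree; the tail of subtree [i] becomes the path for the word
   [[:: i]], and the new tail is empty. *)
exists (fun w => if w is i :: w' then phi i w' else y).
exists (fun w => if w is i :: w' then P i w' else [::]).
split.
- move=> [|i w] /=; first by split=> // z; rewrite inE => /eqP->.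
  by rewrite ltnS => /(wA i)[w_uniq wsub]; split=> // z /wsub /(subsetP (AB i)).
- have yNA i w : size w <= k -> y \notin phi i w :: P i w.
    by case/(wA i) => _ wsub; apply: contra (yA i) => /wsub.
  move=> [|i w] [|i' w'] z //=; rewrite ?ltnS.
  + by move=> _ lew' /predU1P[->|//]; rewrite (negPf (yNA i' w' lew')).
  + by move=> lew _ + /predU1P[zy|//]; rewrite zy (negPf (yNA i w lew)).
  + move=> lew lew' zw zw'; have [eq_i|/dA dii'] := eqVneq i i'.
      rewrite -eq_i in zw' *; case: (hP i) => _ di _ _; congr (_ :: _).
      exact: di zw zw'.
    have [[_ /(_ z zw) zA] [_ /(_ z zw') zA']] := (wA i w lew, wA i' w' lew').
    by rewrite (disjointFr dii' zA) in zA'.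
- move=> [|i w] j /=; first by case: (hP j) => _ _ _ [pj lj]; rewrite rcons_path pj lj xy.
  by rewrite ltnS; case: (hP i) => _ _ + _; apply.
- by [].
Qed.

(** An arc is determined by its source, whose parent is unique, so the path may ignore the target;
    the tail, indexed by the empty word, belongs to no arc. *)
Lemma tree_subdivision (T : finType) (E : rel T) (l k : nat) y (A : {set T}) :
  tree E l k y A -> contains_subdivision (@Barc k l) E.
Proof.
case/tree_words=> phi [P [wA dA ch _]].
pose word (u : Bvert k l) : seq 'I_l := val (tagged u).
have szk u : size (word u) <= k.
  by case: u => d s; rewrite /word /= size_tuple -ltnS.
have word_inj u v : word u = word v -> u = v.
  case: u v => [d s] [d' s']; rewrite /word /= => eq_s; have eq_d : d = d'.
    by apply: val_inj; rewrite /= -(size_tuple s) eq_s size_tuple.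
  by subst d'; congr existT; apply: val_inj.
exists (fun u => phi (word u)), (fun u v => P (word u)); split.
- move=> u v eq_uv; apply: word_inj; apply: (dA _ _ (phi (word u))) => //.
    exact: mem_head.
  by rewrite eq_uv mem_head.
- move=> u v /andP[/eqP + /eqP +]; rewrite -/(word u) -/(word v).
  move: (szk u); case/lastP: (word u) => [|s i] //.
  rewrite size_rcons => lek [eq_s]; rewrite -eq_s -cats1 take_size_cat // => <-.
  by rewrite cats1; apply: ch.
- by move=> u v _; have [/andP[]] := wA _ (szk u).
- move=> u v w _ wP z; apply/eqP => eq_w; have [/andP[+ _] _] := wA _ (szk u).
  have zu : word z = word u.
    by apply: (dA _ _ w); rewrite ?szk // -?eq_w ?mem_head // inE eq_w wP orbT.
  by rewrite -zu eq_w zu wP.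
- move=> u v u' v' /andP[/eqP size_u /eqP take_u] /andP[/eqP size_u' /eqP take_u'].
  move=> w wP wP'; have eq_u : word u = word u'.
    by apply: (dA _ _ w) => //; rewrite inE ?wP ?wP' orbT.
  congr (_, _); apply: word_inj => //; rewrite /word -take_u -take_u'.
  rewrite -/(word u) -/(word u') -eq_u; congr take; apply: succn_inj.
  by rewrite -size_u -size_u' -/(word u) -/(word u') eq_u.
Qed.

(** * Lifting trees from a contracted digraph *)

(** Each [p] stands for [zone p], which is entered through [core p] and left at [tip p]. The depth
    grows by one because a leaf is replaced by the depth-1 tree in its zone. *)
Lemma contract_tree (T T' : finType) (E : rel T) (E' : rel T') (l n : nat)
    (tip : T' -> T) (core zone : T' -> {set T}) :
  (forall p, tree E l 1 (tip p) (zone p)) ->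
  (forall p, core p \subset zone p) ->
  (forall p, #|core p| <= n) ->
  (forall p q, p != q -> [disjoint zone p & zone q]) ->
  (forall p, {in core p, forall w, connect (restrict E (zone p)) w (tip p)}) ->
  (forall p q, E' p q -> exists2 w, w \in core q & E (tip p) w) ->
  forall j p (A : {set T'}), tree E' (n * (l - 1) + 1) j p A ->
  tree E l j.+1 (tip p) (\bigcup_(q in A) zone q).
Proof.
move=> tz cz ltn dz ctip arc j p A.
have dzA q (C : {set T'}) : q \notin C -> forall u,
    u \in \bigcup_(r in C) zone r -> u \in zone q -> False.
  move=> qC u /bigcupP[r rC ur] uq; have neq_rq: r != q by apply: contraNneq qC => <-.
  by rewrite (disjointFr (dz _ _ neq_rq) ur) in uq.
have zS (C D : {set T'}) : C \subset D ->
    \bigcup_(q in C) zone q \subset \bigcup_(q in D) zone q.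
  by move=> CD; apply/bigcupsP => q qC; apply: bigcup_sup; apply: (subsetP CD).
elim=> {j p A} [p A pA|j p q A B tA IH /arc[w wq pw] qA AB qB|
    j p q A B tA IH E'q qA dA AB qB].
- by apply: tree_sub (tz p); apply: bigcup_sup.
- have wz : w \in zone q by apply: (subsetP (cz q)).
  (* The lifted tree is extended to the entry vertex [w]; being otherwise disjoint from [zone q], it
     continues to [tip q] inside that zone. *)
  apply: (@tree_connect _ _ _ _ w _ (w |: \bigcup_(r in A) zone r) _ (zone q)).
  + apply: (TreeStep IH pw); rewrite ?subsetUr // ?setU11 //.
    by apply/negP => /(dzA _ _ qA)/(_ wz).
  + by [].
  + by move=> u u' /setU1P[//|uA] + eq_u; rewrite -eq_u => /(dzA _ _ qA _ uA).
  + rewrite subUset sub1set zS // andbT.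
    by apply/bigcupP; exists q.
  + exact: bigcup_sup.
  + exact: ctip.
have [w hw] := fin_all_exists (fun i => 
  let: ex_intro2 w wq pw := arc _ _ (E'q i) in ex_intro _ w (conj wq pw)).
(* Pigeonhole: [n * (l - 1) + 1] arcs enter a core of at most [n] vertices. *)
have [u uq leu] : exists2 u, u \in core q & l <= #|[set i | w i == u]|.
  apply/exists_inP; apply: contraT => /exists_inPn small.
  have : #|[set: 'I_(n * (l - 1) + 1)]| <= (l - 1) * #|w @: setT|.
    apply: leq_card_fibers => u; have [uq|uNq] := boolP (u \in core q).
      have := small u uq; rewrite -ltnNge => ltl.
      have -> : [set i in setT | w i == u] = [set i | w i == u].
        by apply/setP => i; rewrite !inE.
      by move: #|_| ltl => c; lia.
    rewrite (_ : [set i in _ | _] = set0) ?cards0 //; apply/setP => i; rewrite !inE.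
    by apply: contraNF uNq => /eqP<-; case: (hw i).
  rewrite cardsT card_ord => le1.
  have : #|w @: setT| <= n.
    apply: leq_trans (ltn q); apply: subset_leq_card.
    by apply/subsetP => _ /imsetP[i _ ->]; case: (hw i).
  by move/(leq_mul (leqnn (l - 1))) => le2; have := leq_trans le1 le2; lia.
have [g [g_inj hg]] := set_injection leu.
have uz : u \in zone q by apply: (subsetP (cz q)).
pose C i := \bigcup_(r in A (g i)) zone r.
have uC i : u \notin C i by apply/negP => /(dzA _ _ (qA _))/(_ uz).
apply: (@tree_connect _ _ _ _ u _ (u |: \bigcup_i C i) _ (zone q)).
- apply: (@TreeMerge _ _ _ _ (fun i => tip (p (g i))) u C) => //.
  + by move=> i; case: (hw (g i)) => _; have := hg i; rewrite inE => /eqP->.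
  + move=> i i' neq_i; rewrite -setI_eq0; apply/eqP/setP => v; rewrite !inE.
    apply/negP => /andP[vi /bigcupP[r rA vr]]; apply: (dzA _ _ _ _ vi vr).
    apply/negP => rA'; have := dA (g i) (g i'); rewrite (inj_eq g_inj) => /(_ neq_i).
    by move/disjointFr => /(_ _ rA'); rewrite rA.
  + by move=> i; apply: subset_trans (subsetUr _ _); apply: bigcup_sup.
  + exact: setU11.
- by [].
- move=> v v' /setU1P[//|/bigcupP[i _ vC]] + eq_v; rewrite -eq_v.
  by move=> /(dzA _ _ (qA _) _ vC).
- rewrite subUset sub1set; apply/andP; split; first by apply/bigcupP; exists q.
  by apply/bigcupsP => i _; apply: zS.
- exact: bigcup_sup.
- exact: ctip.
Qed.

(** * Walks along a matching *)

(** Injectivity of [s] lets two meeting walks be traced back together; neither reaches its start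
    before the other, since the starts lie outside [S] and all later vertices in [S]. *)
Lemma walk_inj (T : finType) (s : T -> T) (X S : {set T}) :
  {in X, forall x, s x \in S} -> {in X &, injective s} ->
  forall r q n m, r \notin S -> q \notin S ->
  (forall i, i < n -> iter i s r \in X) -> (forall i, i < m -> iter i s q \in X) ->
  forall i j, i <= n -> j <= m -> iter i s r = iter j s q -> i = j /\ r = q.
Proof.
move=> sS s_inj r q n m rS qS rX qX; elim=> [|i IH] [|j] //= lei lej eq_s.
- by move: rS; rewrite eq_s sS ?qX.
- by move: qS; rewrite -eq_s sS ?rX.
- have [| | |-> ->//] := IH j; try exact: ltnW.
  by apply: s_inj eq_s; [apply: rX | apply: qX].
Qed.

(** A walk that never left [X] would have [#|T| + 1] distinct vertices by [walk_inj]. *)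
Lemma walk_stop (T : finType) (s : T -> T) (X S : {set T}) (r : T) :
  {in X, forall x, s x \in S} -> {in X &, injective s} -> r \notin S ->
  exists n, iter n s r \notin X /\ forall i, i < n -> iter i s r \in X.
Proof.
move=> sS s_inj rS.
have ex_n : exists n, iter n s r \notin X.
  have [|/existsPn allX] := boolP [exists n : 'I_#|T|.+1, iter n s r \notin X].
    by case/existsP=> n; exists n.
  suff /leq_card : injective (fun i : 'I_#|T|.+1 => iter i s r) by rewrite card_ord ltnn.
  move=> i j eq_ij; apply: val_inj.
  have rX i' : i' < #|T| -> iter i' s r \in X.
    by move=> lti; have := allX (Ordinal (ltnW lti : i' < #|T|.+1)); rewrite negbK.
  by have [] := walk_inj sS s_inj rS rS rX rX (ltn_ord i) (ltn_ord j) eq_ij.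
case: (ex_minnP ex_n) => n nX min_n; exists n; split=> // i lt_i.
by apply: contraT => /min_n; rewrite leqNgt lt_i.
Qed.

(** * Partitions into arborescences *)

Lemma b0 l : b 0 l = 1.
Proof. by rewrite /b big_ord1. Qed.

Lemma bS k l : b k.+1 l = 1 + l * b k l.
Proof.
rewrite /b big_ord_recl expn0 big_distrr; congr (_ + _).
by apply: eq_bigr => i _; rewrite expnS.
Qed.

Lemma leq_b i k l : i <= k -> b i l <= b k l.
Proof.
move=> /subnK <-; elim: (k - i) => // d IH; apply: leq_trans IH _.
by rewrite addSn [b _.+1 l]/b big_ord_recr leq_addr.
Qed.

Lemma b_gt0 k l : 0 < b k l.
Proof. by rewrite -(b0 l) leq_b. Qed.

Lemma fSS k l : f k.+2 l =
  f k.+1 (b k.+1 l * (l - 1) + 1) * b k.+1 l * ((l - 1) * k.+2 + 1).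
Proof. by rewrite mulnDr muln1 mulnA. Qed.

Lemma f_gt0 k l : 0 < k -> 0 < l -> 0 < f k l.
Proof.
elim: k l => // -[|k] IH l _ l_gt0 //.
by rewrite fSS !muln_gt0 b_gt0 IH // addn1.
Qed.

(** The last clause lets an arc entering the piece at any vertex be continued to the root. *)
Definition piece (T : finType) (E : rel T) (l i : nat) (r : T) (A : {set T}) :=
  [/\ tree E l i r A, #|A| <= b i l &
      {in A, forall w, connect (restrict E A) w r}].

Lemma piece1 (T : finType) (E : rel T) (l : nat) (r : T) : piece E l 0 r [set r].
Proof.
by split; [apply: TreeLeaf; rewrite inE | rewrite cards1 b0 | move=> w /set1P->].
Qed.

Lemma piece_merge (T : finType) (E : rel T) (l i : nat) (x : 'I_l -> T) y
    (A : 'I_l -> {set T}) :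
  (forall j, piece E l i (x j) (A j)) -> (forall j, E (x j) y) ->
  (forall j, y \notin A j) -> (forall j j', j != j' -> [disjoint A j & A j']) ->
  piece E l i.+1 y (y |: \bigcup_j A j).
Proof.
move=> pA xy yA dA.
have AU j : A j \subset y |: \bigcup_j A j.
  by apply: subset_trans (subsetUr _ _); apply: bigcup_sup.
split.
- apply: (TreeMerge _ xy yA dA AU) => [j|]; first by case: (pA j).
  exact: setU11.
- apply: leq_trans (leq_card_setU _ _) _; rewrite cards1 bS leq_add2l.
  apply: leq_trans (_ : _ <= \sum_(j < l) #|A j|) _.
    elim/big_rec2: _ => [|j n B _ IH]; first by rewrite cards0.
    by apply: leq_trans (leq_card_setU _ _) _; rewrite leq_add2l.
  apply: leq_trans (_ : _ <= \sum_(j < l) b i l) _.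
    by apply: leq_sum => j _; case: (pA j).
  by rewrite sum_nat_const card_ord.
- move=> w /setU1P[->|/bigcupP[j _ wA]]; first exact: connect0.
  case: (pA j) => tA _ /(_ w wA) /(restrict_sub (AU j)) wx.
  apply: connect_trans wx (connect1 _).
  by rewrite /restrict /= xy setU11 (subsetP (AU j)) // (tree_mem tA).
Qed.

(* A partition of the vertices into pieces: [root w] is the root of the piece of
   [w], and [lev (root w)] its depth. *)
Definition forest (T : finType) (E : rel T) (l k : nat) (root : T -> T) (lev : T -> nat) :=
  forall w, [/\ root (root w) = root w, lev (root w) < k &
    piece E l (lev (root w)) (root w) [set u | root u == root w]].

(** A piece of depth 0 has at most [b 0 l = 1] vertices. *)
Lemma forest_single (T : finType) (E : rel T) (l k : nat) root lev v w :
  forest E l k root lev -> lev (root v) = 0 -> (root w == root v) = (w == root v).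
Proof.
move=> /(_ v)[rv _ [tA leA _]] lev0; rewrite lev0 b0 in leA.
have /cards1P[u defA] : #|[set w | root w == root v]| == 1.
  by rewrite eqn_leq leA card_gt0; apply/set0Pn; exists (root v); apply: tree_mem tA.
have ru : root v = u by apply/set1P; rewrite -defA; apply: tree_mem tA.
by transitivity (w \in [set u]); [rewrite -defA inE | rewrite inE ru].
Qed.

(* Merging [l] pieces of the same depth into a one-vertex piece decreases the
   number of pieces. *)
Lemma saturated_forest (T : finType) (E : rel T) (l k : nat) :
  irreflexive E -> 0 < l -> 0 < k ->
  (exists x A, tree E l k x A) \/
  exists root lev, forest E l k root lev /\
    forall v, root v = v -> lev v = 0 -> forall i, i < k ->
    #|[set y | [&& root y == y, lev y == i & E y v]]| < l.
Proof.
move=> hirr l_gt0 k_gt0.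
have : forest E l k (fun w => w) (fun=> 0).
  move=> w; split=> //; rewrite (_ : [set u | _] = [set w]); first exact: piece1.
  by apply/setP => u; rewrite !inE.
move: (fun w => w) (fun=> 0) => root lev.
have [n] := ubnP #|[set w | root w == w]|.
elim: n root lev => // n IH root lev ltn hF.
pose Y v i := [set y | [&& root y == y, lev y == i & E y v]].
have [|noY] := boolP [exists v, [exists i : 'I_k,
    [&& root v == v, lev v == 0 & l <= #|Y v i|]]]; last first.
  right; exists root, lev; split=> // v rv lv i lt_i; rewrite ltnNge.
  apply: contra noY => leY; apply/existsP; exists v; apply/existsP.
  by exists (Ordinal lt_i); rewrite rv lv !eqxx.
case/existsP=> v /existsP[i /and3P[/eqP rv /eqP lv /set_injection[x [x_inj xY]]]].
have {}xY j : [/\ root (x j) = x j, lev (x j) = i & E (x j) v].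
  by have := xY j; rewrite inE => /and3P[/eqP ? /eqP ? ?].
pose A j := [set u | root u == x j].
have xv j : x j != v by case: (xY j) => _ _; apply: contraTneq => ->; rewrite hirr.
have vA j : v \notin A j by rewrite inE rv eq_sym.
have pA j : piece E l i (x j) (A j).
  by have := hF (x j); case: (xY j) => -> -> _ [].
have pv : piece E l i.+1 v (v |: \bigcup_j A j).
  apply: piece_merge => // [j|j j' neq_j]; first by case: (xY j).
  rewrite -setI_eq0; apply/eqP/setP => u; rewrite !inE; apply: contraNF neq_j.
  by case/andP=> /eqP-> /eqP/x_inj->.
(* A merged piece of depth [k] is already the tree sought; otherwise its depth is still below
   [k]. *)
have [eq_k|neq_k] := eqVneq i.+1 k.
  by left; exists v, (v |: \bigcup_j A j); rewrite -eq_k; case: pv.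
pose root' w := if root w \in codom x then v else root w.
pose lev' w := if w == v then i.+1 else lev w.
have vx : v \notin codom x.
  by apply/negP => /codomP[j eq_v]; have := xv j; rewrite eq_v eqxx.
have r'v : root' v = v by rewrite /root' rv; case: ifP.
have cl_v : [set u | root' u == v] = v |: \bigcup_j A j.
  apply/setP => u; rewrite !inE /root'; case: ifP => [/codomP[j ru]|nx].
    by rewrite eqxx; apply/esym/orP; right; apply/bigcupP; exists j; rewrite // inE ru.
  have := forest_single u hF (_ : lev (root v) = 0); rewrite rv => -> //.
  rewrite -[LHS]orbF; congr orb; apply/esym/bigcupP => -[j _]; rewrite inE => /eqP ru.
  by rewrite ru codom_f in nx.
apply: (IH root' lev').
- rewrite -ltnS; apply: leq_trans ltn; rewrite ltnS; apply: proper_card; apply/properP; split.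
    apply/subsetP => w; rewrite !inE /root'; case: ifP => // _ /eqP <-.
    by rewrite rv.
  (* As [l] is positive, some [x j] exists, and it is no longer a root. *)
  have j : 'I_l := Ordinal l_gt0; have [rx _ _] := xY j.
  by exists (x j); rewrite inE ?rx // /root' rx codom_f eq_sym.
- move=> w; have [wx|/negPf nx] := boolP (root w \in codom x).
    have ->: root' w = v by rewrite /root' wx.
    rewrite r'v /lev' eqxx; split=> //; first by rewrite ltn_neqAle neq_k ltn_ord.
    by rewrite cl_v.
  have ->: root' w = root w by rewrite /root' nx.
  have [rw lw pw] := hF w.
  have rw' : root' (root w) = root w by rewrite /root' rw nx.
  have [eq_w|neq_w] := eqVneq (root w) v.
    by rewrite eq_w r'v /lev' eqxx cl_v; split=> //; rewrite ltn_neqAle neq_k ltn_ord.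
  rewrite /lev' (negPf neq_w); split=> //.
  rewrite (_ : [set u | _] = [set u | root u == root w]) //.
  apply/setP => u; rewrite !inE /root'; case: ifP => // ux.
  by rewrite eq_sym (negPf neq_w); apply/esym; apply: contraFF nx => /eqP<-.
Qed.

(** * The induction on the depth *)

Lemma tree_exists (k l : nat) (T : finType) (E : rel T) :
  0 < k -> 1 < l -> irreflexive E -> 0 < #|T| ->
  (forall v, f k l <= outdeg E v) -> exists x A, tree E l k x A.
Proof.
elim: k l T E => // -[_|k IH] l T E _ l_gt1 hirr T_gt0 hdeg.
  (* For depth 1 a vertex with [l] in-neighbours suffices; one exists because the average in-degree
     equals the average out-degree, which is at least [l]. *)
  have [/existsP[v leN]|/existsPn noN] :=
      boolP [exists v, l <= #|[set u | E u v]|].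
    have [x [x_inj xN]] := set_injection leN.
    have xv i : E (x i) v by have := xN i; rewrite inE.
    exists v, setT.
    apply: (@TreeMerge _ _ _ _ x v (fun i => [set x i])) => // i.
    - by apply: TreeLeaf; rewrite inE.
    - by rewrite inE; apply: contraTneq (xv i) => <-; rewrite hirr.
    - by move=> j neq_ij; rewrite disjoints1 inE (inj_eq x_inj).
  have : l * #|[set: T]| <= (l - 1) * #|[set: T]|.
    apply: (double_counting (E := E)) => [x _|y _].
      apply: leq_trans (hdeg x) (subset_leq_card _).
      by apply/subsetP => y; rewrite !inE.
    have := noN y; rewrite -ltnNge => ltl.
    rewrite (_ : [set x in _ | _] = [set u | E u y]); last by apply/setP=> u; rewrite !inE.
    by move: #|_| ltl => c; lia.
  by rewrite cardsT leq_pmul2r //; lia.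
have l_gt0 := ltnW l_gt1.
case: (@saturated_forest _ E l k.+2 hirr l_gt0) => // -[root [lev [hF sat]]].
pose c := k.+2 * (l - 1).
pose n := b k.+1 l; pose m := n * (l - 1) + 1.
have m_gt1 : 1 < m by rewrite /m addn1 ltnS muln_gt0 b_gt0 subn_gt0.
(* With [F = f k.+1 m], the right side is [F * n * (c + 1)], and [F * n] is positive. *)
have f_big : f k.+1 m * n + c <= f k.+2 l.
  have := f_gt0 (isT : 0 < k.+1) (ltnW m_gt1); have := b_gt0 k.+1 l.
  rewrite fSS -/n -/m /c; move: (f _ _) => F n_gt0 F_gt0.
  rewrite mulnDr muln1 addnC leq_add2r mulnC.
  by rewrite -{1}[_ * _]mul1n leq_mul2r muln_gt0 F_gt0 n_gt0 orbT.
have c_gt0 : 0 < c by rewrite muln_gt0 subn_gt0.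
have root_idem w : root (root w) = root w by case: (hF w).
(* [S]: the one-vertex pieces; [X]: the roots matched by [s]; [T']: the roots of
   the larger pieces. *)
pose S := [set v | (root v == v) && (lev v == 0)].
have rootS v w : root v \in S -> root w = root v -> w = root v.
  rewrite inE root_idem eqxx => /eqP lv /eqP; rewrite (forest_single w hF lv).
  by move/eqP.
have indeg v : v \in S -> #|[set x | (root x == x) && E x v]| <= c.
  rewrite inE => /andP[/eqP rv /eqP lv].
  (* The roots are counted by depth: [sat] allows at most [l - 1] for each of the [k.+2] depths. *)
  pose h x : 'I_k.+2 := inord (lev x).
  apply: leq_trans (_ : _ <= (l - 1) * #|h @: [set x | (root x == x) && E x v]|) _.
    apply: leq_card_fibers => j; have := sat v rv lv j (ltn_ord j).
    set Y := [set y | _]; move=> ltY; apply: leq_trans (_ : _ <= #|Y|) _.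
      apply/subset_leq_card/subsetP => x; rewrite !inE => /andP[/andP[/eqP rx ->] /eqP hx].
      rewrite rx eqxx andbT /= -hx inordK //; by have [_ + _] := hF x; rewrite rx.
    by move: #|_| ltY => d; lia.
  rewrite /c mulnC leq_mul2r; apply/orP; right.
  by apply: leq_trans (max_card _) _; rewrite card_ord.
pose X := [set x | (root x == x) && (c <= #|[set y in S | E x y]|)].
have [|y yS|s [sSE s_inj]] := @regular_matching _ E X S c c_gt0.
- by move=> x; rewrite inE => /andP[].
- apply: leq_trans (indeg y yS); apply: subset_leq_card; apply/subsetP => x.
  by rewrite !inE => /andP[/andP[-> _] ->].
have sS : {in X, forall x, s x \in S} by move=> x /sSE[].
pose T' : finType := {r : T | (root r == r) && (0 < lev r)}.
have rT' (p : T') : root (val p) = val p by case/andP: (valP p) => /eqP.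
have T'NS (p : T') : val p \notin S.
  by case/andP: (valP p) => _; rewrite lt0n inE negb_and orbC => ->.
(* The values of [s] are controlled only on [X], so each walk stops on first leaving [X]; [d p] is
   its length. *)
have [d hd] := fin_all_exists (fun p : T' => walk_stop sS s_inj (T'NS p)).
have dN p : iter (d p) s (val p) \notin X by case: (hd p).
have dX p i : i < d p -> iter i s (val p) \in X by case: (hd p) => _; apply.
have iterS p i : 0 < i -> i <= d p -> iter i s (val p) \in S.
  by case: i => // i _ /dX/sS.
pose tip p := iter (d p) s (val p).
pose walk p := [set iter (i : 'I_(d p).+1) s (val p) | i in setT].
pose core (p : T') := [set u | root u == val p].
pose zone p := core p :|: walk p.
have walkP p u : reflect (exists2 i, i <= d p & u = iter i s (val p)) (u \in walk p).
  apply: (iffP imsetP) => [[i _ ->]|[i lei ->]]; first by exists (val i); rewrite // -ltnS ltn_ord.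
  by exists (Ordinal (lei : i < (d p).+1)).
(* After its start a walk stays in [S], whose pieces are single vertices, so it enters no core. *)
have walk_core p q u : u \in walk p -> u \in core q -> p = q /\ u = val p.
  case/walkP=> -[_ ->|i lei ->]; first by rewrite inE rT' => /eqP/val_inj->.
  rewrite [_ \in core q]inE => /eqP ru; have uS := iterS p i.+1 isT lei.
  move: (uS); rewrite inE => /andP[/eqP ru' _].
  by have := T'NS q; rewrite -ru ru' uS.
have dz p q : p != q -> [disjoint zone p & zone q].
  move=> neq_pq; rewrite -setI_eq0; apply/eqP/setP => u; rewrite [RHS]inE.
  apply: contraNF neq_pq => /setIP[/setUP[up|up] /setUP[uq|uq]]; apply/eqP.
  - by move: up uq; rewrite !inE => /eqP-> /eqP/val_inj.
  - by case: (walk_core _ _ _ uq up).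
  - by case: (walk_core _ _ _ up uq).
  - case/walkP: up uq => i lei -> /walkP[j lej].
    by case/(walk_inj sS s_inj (T'NS p) (T'NS q) (dX p) (dX q) lei lej) => _ /val_inj.
have walk_connect p : connect (restrict E (walk p)) (val p) (tip p).
  rewrite /tip; elim: {-2}(d p) (leqnn (d p)) => // i IHi lti.
  apply: connect_trans (IHi (ltnW lti)) (connect1 _).
  have [_ Es] := sSE _ (dX p i lti); rewrite /restrict /= Es /=.
  by apply/andP; split; apply/walkP; [exists i; rewrite // ltnW | exists i.+1].
have core_piece p : piece E l (lev (val p)) (val p) (core p).
  by case: (hF (val p)); rewrite rT'.
have lev_lt (p : T') : lev (val p) < k.+2 by case: (hF (val p)); rewrite rT'.
have tz p : tree E l 1 (tip p) (zone p).
  have [tA _ _] := core_piece p.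
  apply: (tree_connect (tree_leq _ tA) _ _ (subsetUl _ _) (subsetUr _ _) (walk_connect p)).
  - by case/andP: (valP p).
  - by apply/walkP; exists 0.
  - by move=> u v uA vZ eq_u; rewrite -eq_u in vZ; case: (walk_core _ _ _ vZ uA).
have ctip p : {in core p, forall w, connect (restrict E (zone p)) w (tip p)}.
  move=> w wp; have [_ _ /(_ w wp) wr] := core_piece p.
  apply: connect_trans (restrict_sub (subsetUl _ _) wr) _.
  exact: restrict_sub (subsetUr _ _) (walk_connect p).
have ltn p : #|core p| <= n.
  by have [_ leA _] := core_piece p; apply: leq_trans leA (leq_b _ _); rewrite -ltnS.
(* Excluding [p = q] makes [E'] irreflexive; the one out-neighbour that this may cost is paid for by
   the strict inequality [leW]. *)
pose E' : rel T' := fun p q => (p != q) && [exists w in core q, E (tip p) w].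
have arc p q : E' p q -> exists2 w, w \in core q & E (tip p) w.
  by case/andP=> _ /exists_inP.
(* Without larger pieces every vertex would be a root in [S] with in-degree at most [c], against
   out-degrees of at least [f k.+2 l > c]. *)
have T'_gt0 : 0 < #|T'|.
  have [/existsP[w lw]|/existsPn lev0] := boolP [exists w, 0 < lev (root w)].
    have rw : (root (root w) == root w) && (0 < lev (root w)) by rewrite root_idem eqxx.
    by apply/card_gt0P; exists (Sub (root w) rw).
  have inS w : w \in S.
    have rS : root w \in S by rewrite inE root_idem eqxx -leqn0 leqNgt lev0.
    by rewrite (rootS w w rS).
  have : f k.+2 l * #|[set: T]| <= c * #|[set: T]|.
    apply: (double_counting (E := E)) => [x _|y _].
      apply: leq_trans (hdeg x) (subset_leq_card _).
      by apply/subsetP => y; rewrite !inE.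
    apply: leq_trans (indeg y (inS y)); apply/subset_leq_card/subsetP => x.
    have := inS x; rewrite !inE /= => /andP[-> _]; exact: id.
  rewrite cardsT leq_pmul2r // => lec; have := leq_trans f_big lec.
  by rewrite -{2}[c]add0n leq_add2r leqNgt muln_gt0 b_gt0 f_gt0 // ltnW.
have hdeg' p : f k.+1 m <= outdeg E' p.
  have tipX := dN p; rewrite -/(tip p) in tipX.
  have tip_root : root (tip p) = tip p.
    have := iterS p (d p); rewrite /tip; case: (d p) => [|i] /= => [_|/(_ isT)].
      exact: rT'.
    by rewrite leqnn => /(_ isT); rewrite inE => /andP[/eqP].
  (* The tip is a root outside [X], hence the strict inequality. *)
  have few : #|[set y in S | E (tip p) y]| < c.
    by move: tipX; rewrite inE tip_root eqxx -ltnNge.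
  pose W := [set w | E (tip p) w] :\: S.
  have leW : f k.+1 m * n < #|W|.
    have := cardsID S [set w | E (tip p) w].
    rewrite (_ : _ :&: S = [set y in S | E (tip p) y]); last first.
      by apply/setP => y; rewrite !inE andbC.
    have := hdeg (tip p); rewrite /outdeg -/W; move: few f_big.
    move: #|_| #|W| #|_| (f k.+2 l) (_ * n) => u1 u2 u3 u4 u5; lia.
  (* On [W] the value [None] does not occur: a vertex outside [S] has a root of positive depth. *)
  pose g w : option T' := insub (root w).
  have gS w : w \in W -> exists2 q, g w = Some q & val q = root w.
    rewrite !inE => /andP[wS _]; rewrite /g; case: insubP => [q _ <-|]; first by exists q.
    rewrite root_idem eqxx lt0n negbK /= => /eqP lw.
    have rS : root w \in S by rewrite inE root_idem eqxx lw.
    have eq_w := rootS w w rS erefl.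
    by move: rS; rewrite -eq_w inE (negPf wS).
  have le1 : #|W| <= n * #|g @: W|.
    apply: leq_card_fibers => -[q|].
      apply: leq_trans (ltn q); apply/subset_leq_card/subsetP => w.
      rewrite !inE => /andP[wW /eqP gw]; have [|q' gw' <-] := gS w.
        by rewrite !inE.
      by rewrite gw in gw'; case: gw' => ->.
    rewrite (_ : [set w in _ | _] = set0) ?cards0 //.
    apply/setP => w; rewrite [RHS]inE; apply/negP; rewrite inE => /andP[wW].
    by case: (gS w wW) => q ->.
  have le2 : #|g @: W| <= (outdeg E' p).+1.
    rewrite /outdeg; apply: leq_trans (_ : _ <= #|Some @: (p |: [set q | E' p q])|) _.
      apply/subset_leq_card/subsetP => _ /imsetP[w wW ->].
      have [q -> qw] := gS w wW; apply: imset_f; rewrite !inE.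
      have [//|neq_qp] := eqVneq q p; rewrite /E' eq_sym neq_qp /=.
      apply/exists_inP; exists w; first by rewrite inE qw.
      by move: wW; rewrite !inE => /andP[].
    apply: leq_trans (leq_imset_card _ _) _; apply: leq_trans (leq_card_setU _ _) _.
    by rewrite cards1.
  rewrite -ltnS; apply: leq_trans le2; rewrite -(ltn_pmul2l (b_gt0 k.+1 l)).
  by rewrite mulnC; apply: leq_trans leW le1.
have E'irr : irreflexive E' by move=> p; rewrite /E' eqxx.
(* The induction hypothesis is used with the larger branching [m], which [contract_tree] cuts back
   to [l]. *)
have [p [A tA]] := IH m T' E' isT m_gt1 E'irr T'_gt0 hdeg'.
exists (tip p), (\bigcup_(q in A) zone q).
apply: (contract_tree tz _ ltn dz ctip arc tA) => q; exact: subsetUl.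
Qed.

Theorem theorem23 (k l : nat) (hk : 1 <= k) (hl : 2 <= l)
    (T : finType) (E : rel T) (hirr : irreflexive E) (hne : 0 < #|T|)
    (hdeg : forall v : T, f k l <= outdeg E v) :
  contains_subdivision (@Barc k l) E.
Proof.
have [x [A tA]] := tree_exists hk hl hirr hne hdeg.
exact: tree_subdivision tA.
Qed.
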